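(* Let $d\ge 3$, let $\alpha_1,\dots,\alpha_d\ge 2$ be pairwise relatively prime integers, put $\alpha:=\alpha_1\cdots\alpha_d$ and $a_i:=\alpha/\alpha_i$ for $1\le i\le d$. Let $M=\Sigma(\alpha_1,\dots,\alpha_d)$ be the associated Seifert integral homology sphere and $\mathcal{S}_M$ its semigroup. Then $$\mathcal{S}_M=G(a_1,\dots,a_d).$$ That is, the strongly flat semigroups (generated by strongly flat systems of $d\ge 3$ integers with all $\alpha_i\ge 2$) are exactly the numerical semigroups $\mathcal{S}_M$ associated with the Seifert integral homology spheres $M=\Sigma(\alpha_1,\dots,\alpha_d)$.
   Context: For positive integers $a_1,\dots,a_d$ with greatest common divisor $1$, $G(a_1,\dots,a_d)=\{\sum_i k_ia_i : k_i\in\mathbb{Z}_{\ge0}\}$ is the numerical semigroup they generate. The system $a_1,\dots,a_d$ (and the semigroup $G(a_1,\dots,a_d)$) is called strongly flat if, letting $\alpha_i$ be the greatest common divisor of $a_1,\dots,a_{i-1},a_{i+1},\dots,a_d$, one has $a_i=\alpha_1\cdots\alpha_{i-1}\alpha_{i+1}\cdots\alpha_d$ for every $i$ (the $\alpha_i$ are then pairwise relatively prime). For pairwise relatively prime integers $\alpha_1,\dots,\alpha_d\ge 2$ ($d\ge3$) there are unique integers $b_0$ and $\omega_1,\dots,\omega_d$ with $0<\omega_i<\alpha_i$ and $\alpha\big(b_0-\sum_{i=1}^d\omega_i/\alpha_i\big)=1$, where $\alpha=\alpha_1\cdots\alpha_d$. The Seifert integral homology sphere $\Sigma(\alpha_1,\dots,\alpha_d)$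 is the Seifert 3-manifold with normalized Seifert invariants $(-b_0,0;(\alpha_i,\omega_i)_{i=1}^d)$. Its semigroup is $$\mathcal{S}_M:=\{\ell\in\mathbb{Z} : N(\ell)\ge 0\},\qquad N(\ell):=b_0\ell-\sum_{i=1}^d\Big\lceil\frac{\ell\omega_i}{\alpha_i}\Big\rceil .$$ *)

(* Defs.v *)
From HB Require Import structures.
From mathcomp Require Import all_boot all_order all_algebra.
From mathcomp Require Import zify ring.
From mathcomp Require Import boolp classical_sets.

Set Implicit Arguments.
Unset Strict Implicit.
Unset Printing Implicit Defensive.

Import Order.TTheory GRing.Theory Num.Theory.
Local Open Scope classical_set_scope.
Local Open Scope ring_scope.

(* Subsets of nat are viewed inside int, where the semigroup of a Seifert
   manifold lives. *)
Definition semigroup_gen (d : nat) (a : 'I_d -> nat) : set int :=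
  [set l | exists k : 'I_d -> nat, l = (\sum_(i < d) k i * a i)%N%:Z].

(* gcdn 0 n = n, so 0 is the neutral element of the iterated gcd. *)
Definition gcd_family (d : nat) (a : 'I_d -> nat) : nat :=
  \big[gcdn/0%N]_(j < d) a j.

Definition gcd_others (d : nat) (a : 'I_d -> nat) (i : 'I_d) : nat :=
  \big[gcdn/0%N]_(j < d | j != i) a j.

Definition strongly_flat_system (d : nat) (a : 'I_d -> nat) : Prop :=
  [/\ forall i, (0 < a i)%N,
      gcd_family a = 1%N
    & forall i, a i = (\prod_(j < d | j != i) gcd_others a j)%N].

Definition pairwise_coprime (d : nat) (alpha : 'I_d -> nat) : Prop :=
  forall i j, i != j -> coprime (alpha i) (alpha j).

(* Normalized Seifert invariants (- b0, g; (alpha_i, omega_i)_i) of a Seifert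
   3-manifold over the closed orientable surface of genus g: the record stores
   b0, not - b0.  A Seifert manifold enters only through these invariants. *)
Record seifert (d : nat) := Seifert {
  seif_b0 : int;
  seif_genus : nat;
  seif_alpha : 'I_d -> nat;
  seif_omega : 'I_d -> int
}.

(* M = Sigma(alpha_1, ..., alpha_d); see [Sigma_exists_unique]. *)
Definition is_Sigma (d : nat) (alpha : 'I_d -> nat) (M : seifert d) : Prop :=
  [/\ seif_genus M = 0%N,
      seif_alpha M = alpha,
      forall i, 0 < seif_omega M i < (alpha i)%:Z
    & (\prod_(i < d) alpha i)%N%:Q *
        ((seif_b0 M)%:Q - \sum_(i < d) (seif_omega M i)%:Q / (alpha i)%:Q) = 1].

Definition seif_N (d : nat) (M : seifert d) (l : int) : int :=
  seif_b0 M * l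
  - \sum_(i < d) Num.ceil ((l * seif_omega M i)%:Q / (seif_alpha M i)%:Q).

Definition seifert_semigroup (d : nat) (M : seifert d) : set int :=
  [set l | 0 <= seif_N M l].

Section Existence.
Variables (d : nat) (alpha : 'I_d -> nat).
Hypothesis alpha_ge2 : forall i, (2 <= alpha i)%N.
Hypothesis alpha_cop : pairwise_coprime alpha.

Let A := (\prod_(i < d) alpha i)%N.
Let a i := (\prod_(j < d | j != i) alpha j)%N.

Let AE i : A = (alpha i * a i)%N.
Proof. by rewrite /A (bigD1 i). Qed.

Let A_gt0 : (0 < A)%N.
Proof. by apply: prodn_gt0 => i; apply: leq_trans (alpha_ge2 i). Qed.

Let coprime_a i : coprime (alpha i) (a i).
Proof.
rewrite /a; apply: (big_ind (fun n => coprime (alpha i) n)) => [|m n hm hn|j ji].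
- exact: coprimen1.
- by rewrite coprimeMr hm hn.
- by apply: alpha_cop; rewrite eq_sym.
Qed.

Let dvd_a i j : j != i -> (alpha i %| a j)%N.
Proof. by move=> ji; rewrite /a (bigD1 i) 1?eq_sym // dvdn_mulr. Qed.

Let equationE (b : int) (w : 'I_d -> int) :
  (A%:Q * (b%:Q - \sum_(i < d) (w i)%:Q / (alpha i)%:Q) = 1) <->
  (A%:Z * b - \sum_(i < d) w i * (a i)%:Z = 1).
Proof.
have -> : A%:Q * (b%:Q - \sum_(i < d) (w i)%:Q / (alpha i)%:Q) =
          (A%:Z * b - \sum_(i < d) w i * (a i)%:Z)%:Q.
  rewrite mulrBr rmorphB rmorphM /= rmorph_sum /= mulr_sumr; congr (_ - _).
  apply: eq_bigr => i _; rewrite rmorphM /= (AE i) PoszM rmorphM /=.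
  have h : (alpha i)%:Q != 0.
    by rewrite intr_eq0; move: (alpha_ge2 i); case: (alpha i).
  by field.
split=> [h|->] //.
by apply: (@intr_inj rat); rewrite h.
Qed.

Let sum_mod (w : 'I_d -> int) i :
  ((alpha i)%:Z %| (\sum_(j < d) w j * (a j)%:Z) - w i * (a i)%:Z)%Z.
Proof.
rewrite (bigD1 i) //= addrAC subrr add0r.
apply: rpred_sum => j ji; apply: dvdz_mull.
exact: dvd_a.
Qed.

Let prod_dvd (n : nat) : (forall i, alpha i %| n)%N -> (A %| n)%N.
Proof.
move=> dv; rewrite /A; move: (index_enum_uniq 'I_d).
elim: (index_enum _) => [|i s IH] /=; first by rewrite big_nil dvd1n.
case/andP=> nis us; rewrite big_cons Gauss_dvd ?dv ?IH //.
elim: s nis {us IH} => [|j s IH] /=; first by rewrite big_nil coprimen1.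
rewrite inE negb_or => /andP[ij nis].
by rewrite big_cons coprimeMr alpha_cop //= IH.
Qed.

Lemma Sigma_exists_unique : exists! M : seifert d, is_Sigma alpha M.
Proof.
have ex i : exists w : int, 0 < w < (alpha i)%:Z /\
    ((alpha i)%:Z %| 1 + w * (a i)%:Z)%Z.
  have [[u v] /= huv] : {uv : int * int |
      uv.1 * (alpha i)%:Z + uv.2 * (a i)%:Z = 1}.
    have := coprime_a i; rewrite -[coprime _ _]/(coprimez (alpha i) (a i)).
    by move/coprimezP; case/cid=> uv h; exists uv.
  have al0 : (alpha i)%:Z != 0 by move: (alpha_ge2 i); case: (alpha i).
  have hd : ((alpha i)%:Z %| 1 + ((- v) %% (alpha i)%:Z)%Z * (a i)%:Z)%Z.
    have e := divz_eq (- v) (alpha i)%:Z.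
    have -> : ((- v) %% (alpha i)%:Z)%Z = - v - ((- v) %/ (alpha i)%:Z)%Z * (alpha i)%:Z.
      by rewrite {2}e addrC addKr.
    apply/dvdzP; exists (u - ((- v) %/ (alpha i)%:Z)%Z * (a i)%:Z).
    by rewrite -huv; ring.
  exists ((- v) %% (alpha i)%:Z)%Z; split => //.
  rewrite ltz_pmod ?andbT; last by move: (alpha_ge2 i); case: (alpha i).
  rewrite lt_neqAle modz_ge0 // andbT eq_sym; apply/eqP => h0.
  move: hd; rewrite h0 mul0r addr0 dvdzE /= dvdn1 => /eqP h1.
  by have := alpha_ge2 i; rewrite h1.
have [w hw] := choice ex.
have hA : (A%:Z %| 1 + \sum_(j < d) w j * (a j)%:Z)%Z.
  rewrite dvdzE /=; apply: prod_dvd => i.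
  have [_ h1] := hw i; have h2 := sum_mod w i.
  have -> : 1 + \sum_(j < d) w j * (a j)%:Z =
     (1 + w i * (a i)%:Z) + ((\sum_(j < d) w j * (a j)%:Z) - w i * (a i)%:Z).
    by rewrite -addrA [w i * _ + _]addrC subrK.
  by rewrite -[(_ %| _)%N]/((alpha i)%:Z %| _)%Z; apply: rpredD.
have A0 : A%:Z != 0 by move: A_gt0; case: (A).
case/dvdzP: hA => b hb.
exists (Seifert b 0 alpha w); split.
  split=> //= [i|]; first by case: (hw i).
  by apply/equationE; rewrite mulrC -hb addrK.
case=> b' g' al' w' [/= -> -> hw' /equationE he].
have ww : w' = w.
  apply: funext => i.
  have [/andP[w0 wa] h1] := hw i; have /andP[w0' wa'] := hw' i.
  have h1' : ((alpha i)%:Z %| 1 + w' i * (a i)%:Z)%Z.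
    have -> : 1 + w' i * (a i)%:Z = A%:Z * b'
       - ((\sum_(j < d) w' j * (a j)%:Z) - w' i * (a i)%:Z).
      by rewrite -he; ring.
    rewrite rpredB ?sum_mod // dvdz_mulr // (AE i) dvdzE /=.
    exact: dvdn_mulr.
  have h2 : ((alpha i)%:Z %| (w' i - w i) * (a i)%:Z)%Z.
    have -> : (w' i - w i) * (a i)%:Z =
      (1 + w' i * (a i)%:Z) - (1 + w i * (a i)%:Z) by ring.
    exact: rpredB.
  move: h2; rewrite Gauss_dvdzl; last exact: coprime_a.
  rewrite dvdzE /= => /dvdn_leq h3.
  have [/eqP|/h3 h4] := posnP `|w' i - w i|%N.
    by rewrite absz_eq0 subr_eq0 => /eqP.
  lia.
rewrite ww in he *; congr Seifert.
by apply: (mulfI A0); apply: (addIr (- \sum_(i < d) w i * (a i)%:Z));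
  rewrite he mulrC -hb addrK.
Qed.

End Existence.

(* Main.v *)
Require Import Defs.
From mathcomp Require Import all_boot all_order all_algebra.
From mathcomp Require Import boolp classical_sets.
From mathcomp Require Import ring.

(** Put [A := alpha_1 ... alpha_d] and [a_i := A / alpha_i].  Clearing
    denominators, the equation defining [Sigma(alpha_1, ..., alpha_d)] reads
    [A * b0 - sum_i omega_i * a_i = 1].  For an integer [l], let
    [r_i := alpha_i * ceil (l * omega_i / alpha_i) - l * omega_i >= 0] be the
    amount by which [l * omega_i] is rounded up to a multiple of [alpha_i].
    Multiplying [N l] by [A] and using the equation gives ([seif_N_residue])
    [A * N l = l - sum_i r_i * a_i].

    If [N l >= 0], then [l = sum_i r_i * a_i + A * N l], and since [A] is a
    multiple of [a_1] this writes [l] with nonnegative coefficients.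
    Conversely, [omega_i * a_i = -1] modulo [alpha_i], because every other
    term of the equation is divisible by [alpha_i]; so if
    [l = sum_i k_i * a_i] with [k_i >= 0], then [- l * omega_i] and [k_i] are
    congruent modulo [alpha_i].  As [r_i] is the least nonnegative integer in
    that class ([ceil_residue_le]), [r_i <= k_i] for all [i], whence
    [A * N l = sum_i (k_i - r_i) * a_i >= 0].

    It remains to identify the strongly flat systems with the systems
    [(a_i)].  For pairwise coprime [alpha_i], the gcd of the [a_j] with
    [j != i] is [alpha_i] times the gcd of the products of all but one of the
    remaining [alpha_j], and the latter gcd is [1] ([biggcd_prod_others]): a
    prime dividing the product that omits some [j0] divides some [alpha_k],
    and by coprimality it does not divide the product that omits [k].  In the
    other direction, let [alpha_i] be the gcd of the entries other than the
    [i]th of a strongly flat system.  For [i <> j] every entry is divisible by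
    [alpha_i] or by [alpha_j], so a common divisor of the two divides all
    entries and is [1] ([pairwise_coprime_gcd_others]); the corresponding
    Seifert invariants then exist by [Sigma_exists_unique]. *)

Set Implicit Arguments.
Unset Strict Implicit.
Unset Printing Implicit Defensive.

Import Order.TTheory GRing.Theory Num.Theory.
Local Open Scope classical_set_scope.
Local Open Scope ring_scope.

(** * Products of all but one factor *)

Definition prod_others (d : nat) (alpha : 'I_d -> nat) (i : 'I_d) : nat :=
  (\prod_(j < d | j != i) alpha j)%N.

Lemma prod_split d (alpha : 'I_d -> nat) i :
  (\prod_(j < d) alpha j = alpha i * prod_others alpha i)%N.
Proof. by rewrite (bigD1 i). Qed.

Lemma prod_div d (alpha : 'I_d -> nat) i : (0 < alpha i)%N ->
  ((\prod_(j < d) alpha j) %/ alpha i)%N = prod_others alpha i.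
Proof. by move=> alpha_gt0; rewrite (prod_split alpha i) mulKn. Qed.

Lemma dvdn_prod_others d (alpha : 'I_d -> nat) i j :
  j != i -> (alpha i %| prod_others alpha j)%N.
Proof.
by move=> ji; rewrite /prod_others (bigD1 i) 1?eq_sym // dvdn_mulr.
Qed.

(** The predicate [P] makes the lemma apply to the whole family as well as to
    the family with one index removed. *)
Lemma biggcd_prod_others (I : finType) (P : pred I) (alpha : I -> nat) i0 :
    P i0 -> (forall i j, i != j -> coprime (alpha i) (alpha j)) ->
  \big[gcdn/0%N]_(j | P j) (\prod_(k | P k && (k != j)) alpha k)%N = 1%N.
Proof.
move=> Pi0 cop; set g := \big[_/_]_(_ | _) _.
case: (eqVneq g 1%N) => // g_neq1.
have [p p_prime p_dvd_g] : exists2 p, prime p & (p %| g)%N.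
  case: (g) g_neq1 => [|[|n]] // _; first by exists 2%N.
  by exists (pdiv n.+2); [apply: pdiv_prime | apply: pdiv_dvd].
have p_dvd j : P j -> exists2 k, P k && (k != j) & (p %| alpha k)%N.
  move=> Pj; have /dvdn_biggcdP/(_ j Pj) := p_dvd_g.
  by rewrite Euclid_dvd_prod // big_has_cond => /hasP[k _ /andP[Pk pk]]; exists k.
have [k /andP[Pk _] p_dvd_k] := p_dvd i0 Pi0.
have [m /andP[_ mk] p_dvd_m] := p_dvd k Pk.
have : (p %| gcdn (alpha m) (alpha k))%N by rewrite dvdn_gcd p_dvd_m.
by rewrite (eqP (cop m k mk)) dvdn1 => /eqP p1; rewrite p1 in p_prime.
Qed.

(** The factor [alpha_i] is common to all products other than the [i]th; what
    remains after extracting it is a family of products over the indices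
    different from [i], to which the previous lemma applies.  A second index
    is needed for that family to be nonempty. *)
Lemma gcd_others_prod_others d (alpha : 'I_d -> nat) i : (1 < d)%N ->
  pairwise_coprime alpha -> gcd_others (prod_others alpha) i = alpha i.
Proof.
move=> d_gt1 cop.
have [j ji] : exists j : 'I_d, j != i.
  have : (0 < #|predC1 i|)%N.
    by have := cardC1 i; rewrite card_ord => ->; rewrite -subn1 subn_gt0.
  by case/card_gt0P => j; exists j.
rewrite /gcd_others.
transitivity (\big[gcdn/0%N]_(j < d | j != i)
    (alpha i * \prod_(k < d | (k != i) && (k != j)) alpha k))%N.
  apply: eq_bigr => j' j'i; rewrite /prod_others (bigD1 i) 1?eq_sym //=.
  by congr (_ * _)%N; apply: eq_bigl => k; rewrite andbC.
rewrite -(big_morph (muln (alpha i)) (fun m n => muln_gcdr _ m n) (muln0 _)).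
by rewrite (@biggcd_prod_others _ (fun j => j != i) _ j) // muln1.
Qed.

Lemma strongly_flat_prod_others d (alpha : 'I_d -> nat) : (1 < d)%N ->
    (forall i, (0 < alpha i)%N) -> pairwise_coprime alpha ->
  strongly_flat_system (prod_others alpha).
Proof.
move=> d_gt1 alpha_gt0 cop; split=> [i||i].
- exact: prodn_gt0.
- have := @biggcd_prod_others _ predT alpha (Ordinal (ltnW d_gt1)) isT cop.
  by rewrite /gcd_family; under [X in X = _]eq_bigr do rewrite -/(prod_others _ _).
- by apply: eq_bigr => j _; rewrite gcd_others_prod_others.
Qed.

Lemma pairwise_coprime_gcd_others d (a : 'I_d -> nat) :
  gcd_family a = 1%N -> pairwise_coprime (gcd_others a).
Proof.
move=> gcd_a i j ij; rewrite /coprime -dvdn1 -gcd_a.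
apply/dvdn_biggcdP => k _; have [->|ki] := eqVneq k i.
  (* [i] itself is among the indices other than [j]. *)
  by apply: dvdn_trans (dvdn_gcdr _ _) _; apply: (biggcdn_inf i).
by apply: dvdn_trans (dvdn_gcdl _ _) _; apply: (biggcdn_inf k).
Qed.

(** * The Seifert equation over the integers *)

Lemma is_Sigma_eq d (alpha : 'I_d -> nat) (M : seifert d) :
    (forall i, (0 < alpha i)%N) -> is_Sigma alpha M ->
  (\prod_(i < d) alpha i)%N%:Z * seif_b0 M
    - \sum_(i < d) seif_omega M i * (prod_others alpha i)%:Z = 1.
Proof.
move=> alpha_gt0 [_ _ _ eqQ]; apply: (@intr_inj rat); rewrite -[RHS]eqQ.
rewrite mulrBr rmorphB rmorphM /= rmorph_sum /= mulr_sumr; congr (_ - _).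
apply: eq_bigr => i _; rewrite rmorphM /= (prod_split alpha i) PoszM rmorphM /=.
have alpha_neq0 : (alpha i)%:Q != 0 by rewrite intr_eq0 -lt0n.
by field.
Qed.

(** In the Seifert equation, [alpha_i] divides the first term and all terms of
    the sum but the [i]th. *)
Lemma is_Sigma_omega_mod d (alpha : 'I_d -> nat) (M : seifert d) i :
    (forall i, (0 < alpha i)%N) -> is_Sigma alpha M ->
  ((alpha i)%:Z %| 1 + seif_omega M i * (prod_others alpha i)%:Z)%Z.
Proof.
move=> alpha_gt0 /(is_Sigma_eq alpha_gt0) <-.
rewrite [X in _ - X](bigD1 i) //= opprD addrA addrAC subrK.
rewrite rpredB //; first by rewrite (prod_split alpha i) PoszM -mulrA dvdz_mulr.
by apply: rpred_sum => j ji; apply: dvdz_mull; apply: dvdn_prod_others.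
Qed.

(** * The semigroup of a Seifert homology sphere *)

(** For positive [n], this is the residue of [- m] modulo [n] in [0, n). *)
Definition ceil_residue (n : nat) (m : int) : int :=
  n%:Z * Num.ceil (m%:Q / n%:Q) - m.

Lemma ceil_residue_ge0 n m : (0 < n)%N -> 0 <= ceil_residue n m.
Proof.
move=> n_gt0; have n_gt0Q : 0 < n%:Q by rewrite ltr0z ltz_nat.
rewrite subr_ge0 -(@ler_int rat) rmorphM /= mulrC -ler_pdivrMr //.
exact: ceil_ge.
Qed.

(** Rounding up is minimal: any multiple [m + k] of [n] with [k] nonnegative is
    at least the rounded value. *)
Lemma ceil_residue_le (n k : nat) m : (0 < n)%N ->
  (n%:Z %| m + k%:Z)%Z -> ceil_residue n m <= k%:Z.
Proof.
move=> n_gt0 /dvdzP[q mkE]; have n_gt0Q : 0 < n%:Q by rewrite ltr0z ltz_nat.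
rewrite lerBlDl mkE mulrC ler_wpM2r // ceil_le_int ler_pdivrMr //.
by rewrite -rmorphM /= ler_int -mkE lerDl.
Qed.

(** Replacing each ceiling by its argument would turn [A * N l] into [l] times
    the left-hand side of the Seifert equation, that is, into [l]; the sum on
    the right is the total rounding error. *)
Lemma seif_N_residue d (alpha : 'I_d -> nat) (M : seifert d) l :
    (forall i, (0 < alpha i)%N) -> is_Sigma alpha M ->
  (\prod_(i < d) alpha i)%N%:Z * seif_N M l
    = l - \sum_(i < d) ceil_residue (alpha i) (l * seif_omega M i)
                         * (prod_others alpha i)%:Z.
Proof.
move=> alpha_gt0 isM; have eqZ := is_Sigma_eq alpha_gt0 isM.
have [_ alphaE _ _] := isM; rewrite /seif_N alphaE.
rewrite -[X in _ = X - _]mulr1 -eqZ !mulrBr !mulr_sumr -!addrA -!opprD -big_split /=.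
congr (_ - _); first by ring.
by apply: eq_bigr => i _; rewrite /ceil_residue (prod_split alpha i) PoszM; ring.
Qed.

Lemma semigroup_genP d (a : 'I_d -> nat) (k : 'I_d -> int) :
    (forall i, 0 <= k i) ->
  semigroup_gen a (\sum_(i < d) k i * (a i)%:Z).
Proof.
move=> k_ge0; exists (fun i => `|k i|%N).
rewrite (big_morph Posz PoszD (erefl _)).
by apply: eq_bigr => i _; rewrite PoszM gez0_abs.
Qed.

Lemma seifert_semigroup_gen d (alpha : 'I_d -> nat) (M : seifert d) :
    (0 < d)%N -> (forall i, (0 < alpha i)%N) -> is_Sigma alpha M ->
  seifert_semigroup M = semigroup_gen (prod_others alpha).
Proof.
move=> d_gt0 alpha_gt0 isM.
have A_gt0 : (0 : int) < (\prod_(i < d) alpha i)%N by rewrite ltz_nat prodn_gt0.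
have NE l := seif_N_residue l alpha_gt0 isM.
apply/seteqP; split=> l /= => [N_ge0|[k lE]].
  pose i0 := Ordinal d_gt0.
  (* [A * N l] is absorbed by the first generator, [A] being [alpha_1 * a_1]. *)
  pose k i := ceil_residue (alpha i) (l * seif_omega M i)
                + (if i == i0 then (alpha i)%:Z * seif_N M l else 0).
  have k_ge0 i : 0 <= k i.
    rewrite addr_ge0 ?ceil_residue_ge0 //.
    by case: ifP => // _; rewrite mulr_ge0.
  suff -> : l = \sum_(i < d) k i * (prod_others alpha i)%:Z.
    exact: semigroup_genP.
  under eq_bigr do rewrite mulrDl.
  rewrite big_split /= [X in _ + X](bigD1 i0) //=.
  rewrite [X in _ + (_ + X)]big1 => [|i /negPf->]; last by rewrite mul0r.
  by rewrite addr0 mulrAC -PoszM -prod_split NE addrC subrK.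
have {}lE : l = \sum_(i < d) (k i)%:Z * (prod_others alpha i)%:Z.
  by rewrite lE (big_morph Posz PoszD (erefl _)).
rewrite /seifert_semigroup /= -(pmulr_rge0 _ A_gt0) NE [X in X - _]lE -sumrB.
apply: sumr_ge0 => i _; rewrite -mulrBl mulr_ge0 // subr_ge0.
apply: ceil_residue_le => //.
have -> : l * seif_omega M i + (k i)%:Z
    = (k i)%:Z * (1 + seif_omega M i * (prod_others alpha i)%:Z)
      + seif_omega M i * (l - (k i)%:Z * (prod_others alpha i)%:Z) by ring.
apply: rpredD; first by apply: dvdz_mull; apply: is_Sigma_omega_mod.
apply: dvdz_mull; rewrite {1}lE (bigD1 i) //= addrAC subrr add0r.
by apply: rpred_sum => j ji; apply: dvdz_mull; apply: dvdn_prod_others.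
Qed.

Theorem theorem4p1p1 (d : nat) (d_ge3 : (3 <= d)%N) :
  (forall alpha : 'I_d -> nat,
     (forall i, (2 <= alpha i)%N) ->
     pairwise_coprime alpha ->
     forall M : seifert d, is_Sigma alpha M ->
       seifert_semigroup M =
       semigroup_gen (fun i : 'I_d => ((\prod_(j < d) alpha j) %/ alpha i)%N))
  /\
  (forall S : set int,
     (exists a : 'I_d -> nat,
        [/\ strongly_flat_system a,
            forall i, (2 <= gcd_others a i)%N
          & S = semigroup_gen a])
     <->
     (exists (alpha : 'I_d -> nat) (M : seifert d),
        [/\ forall i, (2 <= alpha i)%N,
            pairwise_coprime alpha,
            is_Sigma alpha M
          & S = seifert_semigroup M])).
Proof.
have d_gt1 : (1 < d)%N := ltnW d_ge3.
have d_gt0 : (0 < d)%N := ltnW d_gt1.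
have pos (alpha : 'I_d -> nat) :
    (forall i, (2 <= alpha i)%N) -> forall i, (0 < alpha i)%N.
  by move=> alpha_ge2 i; apply: ltnW.
split=> [alpha /pos alpha_gt0 cop M isM|S].
  rewrite (seifert_semigroup_gen d_gt0 alpha_gt0 isM); congr semigroup_gen.
  by apply: funext => i; rewrite prod_div.
split=> [[a [[_ gcd_a aE] alpha_ge2 ->]]|[alpha [M [alpha_ge2 cop isM ->]]]].
  have cop := pairwise_coprime_gcd_others gcd_a.
  have [M [isM _]] := Sigma_exists_unique alpha_ge2 cop.
  exists (gcd_others a), M; split=> //.
  rewrite (seifert_semigroup_gen d_gt0 (pos _ alpha_ge2) isM).
  by congr semigroup_gen; apply: funext => i; rewrite aE.
exists (prod_others alpha); split.
- by apply: strongly_flat_prod_others => //; apply: pos.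
- by move=> i; rewrite gcd_others_prod_others.
- by apply: seifert_semigroup_gen => //; apply: pos.
Qed.
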